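(* Let $p\in[1,\infty)$, let $(X,d_X)$ be a metric space and let $(Y,\|\cdot\|)$ be a Banach space. If $X$ is locally bi-Lipschitzly representable into $Y$, then $X$ admits a bi-Lipschitz embedding into $\ell_p(Y)$.
   Context: For $\lambda\in[1,\infty)$, a metric space $(X,d_X)$ is locally $\lambda$-Lipschitz representable into a metric space $(Y,d_Y)$ if for every metric ball $B$ in $X$ there are a map $f_B\colon B\to Y$ and a scaling factor $s>0$ (which may depend on $B$) such that $s\,d_X(x,y)\le d_Y(f_B(x),f_B(y))\le \lambda s\, d_X(x,y)$ for all $x,y\in B$. It is locally bi-Lipschitzly representable into $Y$ if it is locally $\lambda$-Lipschitz representable into $Y$ for some $\lambda\in[1,\infty)$ (the same $\lambda$ for all balls). A bi-Lipschitz embedding of $(X,d_X)$ into a Banach space $Z$ is a map $f\colon X\to Z$ for which there exist constants $s>0$ and $D\in[1,\infty)$ with $s\,d_X(x,y)\le \|f(x)-f(y)\|\le D s\,d_X(x,y)$ for all $x,y\in X$. $\ell_p(Y)$ is the Banach space of sequences $(y_n)_{n\ge1}$ in $Y$ with $\sum_n\|y_n\|^p<\infty$, with norm $(\sum_n\|y_n\|^p)^{1/p}$. *)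

(* Defs.v *)
From HB Require Import structures.
From mathcomp Require Import all_boot all_order all_algebra.
From mathcomp Require Import all_classical all_reals all_analysis.

Set Implicit Arguments.
Unset Strict Implicit.
Unset Printing Implicit Defensive.

Import Order.TTheory GRing.Theory Num.Theory.
Import numFieldNormedType.Exports.

Local Open Scope classical_set_scope.
Local Open Scope ring_scope.

(* [ball c r] is the open ball [[set x | mdist c x < r]].  The map [f] is a
   total function of which only the values on the ball are constrained. *)
Definition locally_Lipschitz_representable (R : realType) (lambda : R)
    (X Y : metricType R) : Prop :=
  forall (c : X) (r : R), 0 < r ->
    exists (f : X -> Y) (s : R), 0 < s /\
      forall x y, ball c r x -> ball c r y ->
        s * mdist x y <= mdist (f x) (f y) <= lambda * s * mdist x y.

Definition locally_biLipschitz_representable (R : realType)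
    (X Y : metricType R) : Prop :=
  exists lambda : R, 1 <= lambda /\ locally_Lipschitz_representable lambda X Y.

Definition biLipschitz_embedding (R : realType) (X : metricType R)
    (Z : completeNormedModType R) (f : X -> Z) : Prop :=
  exists s D : R, [/\ 0 < s, 1 <= D &
    forall x y, s * mdist x y <= `|f x - f y| <= D * s * mdist x y].

(* The library has no [metricType] instance for normed modules: [norm_metric V]
   is [V] with the distance `|x - y|. *)
Definition norm_metric (R : realType) (V : normedModType R) : Type := V.

Section norm_metric.
Context (R : realType) (V : normedModType R).

HB.instance Definition _ := PseudoMetric.copy (norm_metric V) V.

Let dist (x y : norm_metric V) : R := `|(x : V) - y|.

Let dist_ge0 x y : 0 <= dist x y.
Proof. exact: normr_ge0. Qed.

Let dist_positivity x y : dist x y = 0 -> x = y.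
Proof. by move/normr0_eq0/eqP; rewrite subr_eq0 => /eqP. Qed.

Let ballEdist x d : ball x d = [set y | dist x y < d].
Proof. by rewrite -[LHS]/(@ball R V x d) -ball_normE. Qed.

HB.instance Definition _ := PseudoMetric_isMetric.Build R (norm_metric V)
  dist_ge0 dist_positivity ballEdist.

Lemma mdist_normE (x y : V) :
  mdist (x : norm_metric V) (y : norm_metric V) = `|x - y|.
Proof. by []. Qed.

End norm_metric.

Section lp_norm.
Context (R : realType) (Y : normedModType R).
Implicit Types (p : R) (y : nat -> Y).

Definition lp_sum p y : \bar R := (\sum_(0 <= n <oo) (`|y n| `^ p)%:E)%E.

Definition lp_pred p : {pred (nat -> Y)} := fun y => (lp_sum p y < +oo)%E.

Definition lp_norm p y : R := fine (lp_sum p y) `^ p^-1.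

Lemma lp_sum_ge0 p y : (0 <= lp_sum p y)%E.
Proof. by apply: nneseries_ge0 => n _ _; rewrite lee_fin powR_ge0. Qed.

Lemma lp_norm_ge0 p y : 0 <= lp_norm p y.
Proof. exact: powR_ge0. Qed.

Lemma lp_sum_partial_le p y N :
  ((\sum_(0 <= n < N) `|y n| `^ p)%:E <= lp_sum p y)%E.
Proof.
rewrite -sumEFin; apply: nneseries_lim_ge => n _ _.
by rewrite lee_fin powR_ge0.
Qed.

Lemma lp_sum_le p y (M : \bar R) :
  (forall N, (\sum_(0 <= n < N) `|y n| `^ p)%:E <= M)%E -> (lp_sum p y <= M)%E.
Proof.
move=> leM; apply: lime_le.
  by apply: is_cvg_nneseries => n _ _; rewrite lee_fin powR_ge0.
by apply: nearW => N; rewrite sumEFin.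
Qed.

Lemma lp_norm_Lnorm p y : 0 < p -> y \in lp_pred p ->
  ((lp_norm p y)%:E = 'N[counting]_p%:E[EFin \o (fun n => `|y n|%R)])%E.
Proof.
move=> p0 yp; rewrite Lnorm_counting// /lp_norm -poweR_EFin fineK; last first.
  by rewrite ge0_fin_numE// lp_sum_ge0.
by congr poweR; apply: eq_eseriesr => n _ /=; rewrite normr_id.
Qed.

Lemma lp_predE p y : 0 < p -> (y \in lp_pred p) =
  ('N[counting]_p%:E[EFin \o (fun n => `|y n|%R)] < +oo)%E.
Proof.
move=> p0; apply/idP/idP => [yp|]; first by rewrite -lp_norm_Lnorm// ltry.
rewrite Lnorm_counting// => /lty_poweRy; rewrite invr_eq0 gt_eqF// => /(_ isT).
rewrite unfold_in /lp_pred; apply: le_lt_trans.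
rewrite le_eqVlt; apply/orP; left; apply/eqP.
by apply: eq_eseriesr => n _ /=; rewrite normr_id.
Qed.

Let minkowski_norm p x y : 1 <= p ->
  ('N[counting]_p%:E[EFin \o (fun n => `|(x + y)%R n|%R)] <=
   'N[counting]_p%:E[EFin \o (fun n => `|x n|%R)] +
   'N[counting]_p%:E[EFin \o (fun n => `|y n|%R)] :> \bar R)%E.
Proof.
move=> p1; have p0 : 0 < p by exact: lt_le_trans p1.
apply: le_trans; last by apply: minkowski_EFin.
rewrite !Lnorm_counting//; apply: gt0_ler_poweR.
- by rewrite invr_ge0 ltW.
- by rewrite in_itv/= leey andbT; apply: nneseries_ge0 => n _ _;
    rewrite ?lee_fin ?powR_ge0 ?poweR_ge0.
- by rewrite in_itv/= leey andbT; apply: nneseries_ge0 => n _ _;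
    rewrite ?lee_fin ?powR_ge0 ?poweR_ge0.
apply: lee_nneseries => [n _ _|n _]; first exact: poweR_ge0.
rewrite /= lee_fin normr_id; apply: ge0_ler_powR; rewrite ?nnegrE//.
  exact: ltW.
by rewrite ger0_norm ?addr_ge0// ler_normD.
Qed.

Lemma lp_predD p x y : 1 <= p ->
  x \in lp_pred p -> y \in lp_pred p -> x + y \in lp_pred p.
Proof.
move=> p1; have p0 : 0 < p by exact: lt_le_trans p1.
rewrite !lp_predE// => xp yp.
by rewrite (le_lt_trans (minkowski_norm _ _ p1))// lte_add_pinfty.
Qed.

Lemma ler_lp_normD p x y : 1 <= p -> x \in lp_pred p -> y \in lp_pred p ->
  lp_norm p (x + y) <= lp_norm p x + lp_norm p y.
Proof.
move=> p1 xp yp; have p0 : 0 < p by exact: lt_le_trans p1.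
have := minkowski_norm x y p1.
rewrite -(lp_norm_Lnorm p0 xp) -(lp_norm_Lnorm p0 yp).
rewrite -(lp_norm_Lnorm p0 (lp_predD p1 xp yp)).
by rewrite -EFinD lee_fin.
Qed.

Lemma lp_sumZ p (a : R) y : lp_sum p (a *: y) = ((`|a| `^ p)%:E * lp_sum p y)%E.
Proof.
rewrite /lp_sum -nneseriesZl; last by move=> n _; rewrite lee_fin powR_ge0.
by apply: eq_eseriesr => n _; rewrite -EFinM -powRM// -normrZ.
Qed.

Lemma lp_predZ p (a : R) y : y \in lp_pred p -> a *: y \in lp_pred p.
Proof.
rewrite !unfold_in /lp_pred lp_sumZ => yp.
by rewrite lte_mul_pinfty ?lee_fin ?powR_ge0.
Qed.

Lemma lp_normZ p (a : R) y : 0 < p -> y \in lp_pred p ->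
  lp_norm p (a *: y) = `|a| * lp_norm p y.
Proof.
move=> p0 yp; rewrite /lp_norm lp_sumZ fineM//; last first.
  by rewrite ge0_fin_numE ?lp_sum_ge0.
rewrite powRM ?powR_ge0 ?fine_ge0 ?lp_sum_ge0//.
by rewrite -powRrM mulfV ?gt_eqF// powRr1.
Qed.

Lemma lp_pred0 p : 0 < p -> (0 : nat -> Y) \in lp_pred p.
Proof.
move=> p0; rewrite unfold_in /lp_pred; apply: le_lt_trans (ltry 0).
apply: lp_sum_le => N; rewrite lee_fin big1// => n _.
by rewrite normr0 powR0// gt_eqF.
Qed.

Lemma lp_sum_norm p y : 0 < p -> y \in lp_pred p ->
  lp_sum p y = (lp_norm p y `^ p)%:E.
Proof.
move=> p0 yp; rewrite /lp_norm -powRrM mulVf ?gt_eqF// powRr1.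
  by rewrite fineK// ge0_fin_numE// lp_sum_ge0.
by rewrite fine_ge0// lp_sum_ge0.
Qed.

Lemma ler_lp_norm p y n : 0 < p -> y \in lp_pred p -> `|y n| <= lp_norm p y.
Proof.
move=> p0 yp; rewrite leNgt; apply/negP => lt_y.
have := lp_sum_partial_le p y n.+1; rewrite lp_sum_norm// lee_fin leNgt => /negP.
apply; rewrite big_nat_recr//=; apply: (@lt_le_trans _ _ (`|y n| `^ p)).
  by apply: gt0_ltr_powR; rewrite ?nnegrE ?lp_norm_ge0.
by rewrite lerDr sumr_ge0// => i _; rewrite powR_ge0.
Qed.

Lemma lp_norm_le p y (e : R) : 0 < p -> 0 <= e ->
  (forall N, \sum_(0 <= n < N) `|y n| `^ p <= e `^ p) ->
  y \in lp_pred p /\ lp_norm p y <= e.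
Proof.
move=> p0 e0 le_e.
have le_sum : (lp_sum p y <= (e `^ p)%:E)%E.
  by apply: lp_sum_le => N; rewrite lee_fin.
have yp : y \in lp_pred p by apply: le_lt_trans le_sum (ltry _).
split=> //; move: le_sum; rewrite lp_sum_norm// lee_fin.
move=> le_pe; rewrite leNgt; apply/negP => lt_e; move: le_pe; rewrite leNgt.
by move/negP; apply; apply: gt0_ltr_powR; rewrite ?nnegrE ?lp_norm_ge0.
Qed.

Lemma cvg_powR_ge0 (T : Type) (F : set_system T) (FF : Filter F)
    (u : T -> R) (l p : R) : 0 < p -> 0 <= l -> (forall t, 0 <= u t) ->
  u t @[t --> F] --> l -> u t `^ p @[t --> F] --> l `^ p.
Proof.
move=> p0; rewrite le_eqVlt => /predU1P[<-|l0] u0 ul.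
  rewrite powR0 ?gt_eqF//; apply/cvgr0Pnorm_lt => e e0.
  move/cvgr0Pnorm_lt : ul => /(_ (e `^ p^-1)); rewrite powR_gt0// => /(_ isT).
  apply: filterS => t; rewrite !ger0_norm ?powR_ge0// => ue.
  rewrite -[ltRHS](@powRr1 _ e) ?ltW// -(mulVf (lt0r_neq0 p0)) powRrM.
  by apply: gt0_ltr_powR; rewrite ?nnegrE ?powR_ge0.
apply: (cvg_comp u (fun a => a `^ p) ul).
have : {for l, continuous (fun a : R => a `^ p)}.
  apply/differentiable_continuous/derivable1_diffP/derivable_powR.
  by rewrite in_itv/= andbT.
exact.
Qed.

End lp_norm.

(* The space l_p(Y), 1 <= p < +oo, with sequences indexed from 0. *)
Record lp_space (R : realType) (Y : normedModType R) (p : R) (p1 : 1 <= p) :=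
  LpSpace { lp_seq :> nat -> Y ; _ : lp_seq \in lp_pred p }.

Section lp_space.
Context (R : realType) (Y : normedModType R) (p : R) (p1 : 1 <= p).
Notation lp := (lp_space Y p1).

Let p0 : 0 < p. Proof. exact: lt_le_trans p1. Qed.

HB.instance Definition _ := [isSub for @lp_seq R Y p p1].
HB.instance Definition _ := [Choice of lp by <:].

Lemma lp_seqP (y : lp) : (y : nat -> Y) \in lp_pred p.
Proof. exact: valP. Qed.

Let lp_submod_closed : submod_closed (lp_pred (Y := Y) p).
Proof.
split=> [|a x y xp yp]; first exact: lp_pred0.
by apply: (lp_predD p1 _ yp); exact: lp_predZ.
Qed.

#[local] HB.instance Definition _ :=
  GRing.isSubmodClosed.Build R (nat -> Y) (lp_pred p) lp_submod_closed.
HB.instance Definition _ := [SubChoice_isSubLmodule of lp by <:].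

Let norm (y : lp) : R := lp_norm p y.

Let norm_triangle (x y : lp) : norm (x + y) <= norm x + norm y.
Proof. by apply: ler_lp_normD => //; exact: lp_seqP. Qed.

Let normZ (a : R) (x : lp) : norm (a *: x) = `|a| * norm x.
Proof. by apply: lp_normZ => //; exact: lp_seqP. Qed.

Let norm_eq0 (x : lp) : norm x = 0 -> x = 0.
Proof.
move=> x0; apply/val_inj/funext => n /=; apply/eqP; rewrite -normr_le0.
by rewrite -x0; apply: ler_lp_norm => //; exact: lp_seqP.
Qed.

HB.instance Definition _ :=
  Lmodule_isNormed.Build R lp norm_triangle normZ norm_eq0.

Lemma ler_norm_lp_seq (y : lp) n : `|y n| <= `|y|.
Proof. by apply: ler_lp_norm => //; exact: lp_seqP. Qed.

Lemma lp_norm_partial_le (y : lp) N : \sum_(0 <= n < N) `|y n| `^ p <= `|y| `^ p.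
Proof.
by have := lp_sum_partial_le p y N; rewrite lp_sum_norm ?lp_seqP// lee_fin.
Qed.

Lemma lp_normE (y : lp) :
  `|y| = fine (\sum_(0 <= n <oo) (`|y n| `^ p)%:E)%E `^ p^-1.
Proof. by []. Qed.

End lp_space.

Section lp_space_complete.
Context (R : realType) (Y : completeNormedModType R) (p : R) (p1 : 1 <= p).
Notation lp := (lp_space Y p1).

Let p0 : 0 < p. Proof. exact: lt_le_trans p1. Qed.

Let lp_complete (F : set_system lp) : ProperFilter F -> cauchy F -> cvg F.
Proof.
move=> FF /cauchyP Fc.
have Fcvg n : cvg ((y : nat -> Y) n @[y --> F]).
  apply: cauchy_cvg; apply/cauchyP => e e0.
  have [x Fx] := Fc _ e0; exists (x n).
  change (F [set y : lp | ball (x n) e (y n)]).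
  apply: filterS Fx => y; rewrite -!ball_normE/=; apply: le_lt_trans.
  exact: (ler_norm_lp_seq (x - y)).
pose z n := lim ((y : nat -> Y) n @[y --> F]).
have near_z e : 0 < e -> exists x : lp, F (ball x e) /\
    ((x : nat -> Y) - z \in lp_pred p /\ lp_norm p ((x : nat -> Y) - z) <= e).
  move=> e0; have [x Fx] := Fc _ e0; exists x; split=> //.
  apply: lp_norm_le => //; first exact: ltW.
  move=> N.
  have cvgz : \sum_(0 <= n < N) `|x n - y n| `^ p @[y --> F] -->
              \sum_(0 <= n < N) `|x n - z n| `^ p.
    apply: cvg_big => [|n _]; first exact: add_continuous.
    apply: cvg_powR_ge0 => //.
    by apply: cvg_norm; apply: cvgB; [exact: cvg_cst|exact: Fcvg].
  apply: (cvgr_to_le cvgz).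
  change (F [set y : lp | \sum_(0 <= n < N) `|x n - y n| `^ p <= e `^ p]).
  apply: filterS Fx => y; rewrite -ball_normE/= => xy.
  apply: (le_trans (lp_norm_partial_le (x - y) N)).
  by apply: ge0_ler_powR; rewrite ?nnegrE//; exact: ltW.
have zp : z \in lp_pred p.
  have [x [_ [xzp _]]] := near_z _ ltr01.
  rewrite (_ : z = (x : nat -> Y) + (-1) *: ((x : nat -> Y) - z)); last first.
    by rewrite scaleN1r opprB addrC subrK.
  by apply: lp_predD; rewrite ?lp_predZ ?lp_seqP.
pose zl : lp := LpSpace p1 zp.
apply/cvg_ex; exists zl; apply/cvgrPdist_lt => e e0.
have [x [Fx [_ xz]]] := near_z _ (divr_gt0 e0 (ltr0n R 2)).
have {}xz : `|x - zl| <= e / 2 by exact: xz.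
apply: filterS Fx => y; rewrite -ball_normE/= => xy.
apply: (le_lt_trans (ler_distD x _ _)).
rewrite (splitr e) distrC; exact: ler_ltD xz xy.
Qed.

HB.instance Definition _ := Uniform_isComplete.Build lp lp_complete.

End lp_space_complete.

(* Main.v *)
Require Import Defs.
From mathcomp Require Import all_boot all_order all_algebra.
From mathcomp Require Import all_classical all_reals all_analysis.
From mathcomp Require Import lra zify.

Import Order.TTheory GRing.Theory Num.Theory.
Import numFieldNormedType.Exports.

Local Open Scope ring_scope.

(** The maps given on balls are glued along dyadic shells around a base point
    [c]; the metric does not have to be locally finite, because the scales of
    the local maps can be normalized inside the vector space [Y].

    Let [T x = 1 + d(c, x)], so that [1 <= T].  For every [n], translating and
    dividing by the scaling factor yields a map [g_n] with [g_n c = 0] and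
    [d(x, y) <= |g_n x - g_n y| <= lam d(x, y)] on a ball containing the set
    [T < (5/2) 2^n].  With a trapezoidal cutoff [phi], equal to 1 on [1, 2] and
    to 0 off ]1/2, 5/2[, and a unit vector [u] of [Y], put
      [F x = (d(c, x) u, phi (T x / 2^0) g_0 x, phi (T x / 2^1) g_1 x, ...)].

    Upper bound.  On the support of the [n]-th cutoff [|g_n|] is at most
    [(5/2) lam 2^n], while the cutoff is [2 / 2^n]-Lipschitz; by the product
    rule every coordinate is [6 lam]-Lipschitz ([cutoff_lipschitz]).  At most
    three cutoffs are nonzero at a given point ([window_sum]), so that [F x - F y]
    has at most seven nonzero coordinates, and its l_p norm is at most seven
    times their largest norm ([lp_norm_sparse]).

    Lower bound.  Let [d(c, y) <= d(c, x)] and [2^n <= T x <= 2^(n+1)].  The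
    [n]-th cutoff is 1 at [x], so that the [n]-th coordinate of [F x - F y] is
    [g_n x - g_n y] up to an error of at most [5 lam (d(c, x) - d(c, y))]
    ([cutoff_expansive]).  The coordinate along [u] controls precisely
    [d(c, x) - d(c, y)], whence [d(x, y) <= (1 + 5 lam) |F x - F y|]. *)

(** * The cutoff function *)

(** The trapezoid equal to 1 on [1, 2], to 0 off ]1/2, 5/2[, and affine on the
    two remaining intervals. *)
Definition trapezoid (R : realType) (t : R) : R :=
  Num.max 0 (Num.min 1 (2 - `|2 * t - 3|)).

Lemma trapezoid_itv (R : realType) (t : R) : 0 <= trapezoid R t <= 1.
Proof. by rewrite /trapezoid le_max lexx/= ge_max ler01 ge_min lexx. Qed.

Lemma trapezoid1 (R : realType) (t : R) : 1 <= t <= 2 -> trapezoid R t = 1.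
Proof.
move=> /andP[t1 t2]; have : `|2 * t - 3| <= 1 by rewrite ler_norml; lra.
by move=> t3; rewrite /trapezoid min_l ?max_r//; lra.
Qed.

Lemma trapezoid_supp (R : realType) (t : R) :
  trapezoid R t != 0 -> 1 / 2 < t < 5 / 2.
Proof.
apply: contraNT => /negP tN; apply/eqP; rewrite /trapezoid max_l//.
rewrite ge_min; apply/orP; right; rewrite subr_le0 leNgt.
by apply/negP; rewrite ltr_norml => tI; apply: tN; lra.
Qed.

Lemma trapezoid_lipschitz (R : realType) (s t : R) :
  `|trapezoid R s - trapezoid R t| <= 2 * `|s - t|.
Proof.
have clamp (a b : R) :
    `|Num.max 0 (Num.min 1 a) - Num.max 0 (Num.min 1 b)| <= `|a - b|.
  have ab : a - b <= `|a - b| by exact: ler_norm.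
  have ba : b - a <= `|a - b| by rewrite distrC ler_norm.
  rewrite ler_norml /Num.max /Num.min.
  by do !case: ifPn; rewrite -?leNgt; move: ab ba; lra.
apply: (le_trans (clamp _ _)).
have -> : 2 - `|2 * s - 3| - (2 - `|2 * t - 3|) = `|2 * t - 3| - `|2 * s - 3|.
  by lra.
apply: (le_trans (ler_dist_dist _ _)).
have -> : 2 * t - 3 - (2 * s - 3) = 2 * (t - s) by lra.
by rewrite normrM ger0_norm// (distrC s).
Qed.

(** * Dyadic scales *)

Lemma dyadic_bracket (R : realType) (t : R) :
  1 <= t -> exists n, 2 ^+ n <= t <= 2 ^+ n.+1.
Proof.
move=> t1; have t_lt : exists n, t < 2 ^+ n.
  exists (Num.trunc t).+1; apply: (lt_trans (truncnS_gt t)).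
  by rewrite -natrX ltr_nat ltn_expl.
case: (ex_minnP t_lt) => -[|n] tn n_min; first by move: tn; rewrite expr0; lra.
exists n; rewrite (ltW tn) andbT leNgt; apply/negP => /n_min.
by rewrite ltnn.
Qed.

(** If any two elements of [P] differ by less than [k], then [P] has at most
    [k] elements. *)
Lemma window_sum (P : pred nat) (k N : nat) :
  (forall m n, P m -> P n -> (n < m + k)%N) ->
  (\sum_(0 <= n < N) P n <= k)%N.
Proof.
move=> Pk; have [[n Pn]|P0] := pselect (exists n, P n); last first.
  rewrite big1// => n _; have [Pn|//] := boolP (P n).
  by case: P0; exists n.
case: (ex_minnP (ex_intro P n Pn)) => m Pm m_min.
suff : (\sum_(0 <= n < N) P n <= minn (N - m) k)%N.
  by move/leq_trans; apply; rewrite geq_minr.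
elim: N => [|N IHN]; first by rewrite big_geq.
rewrite big_nat_recr//=; have [PN|_] := boolP (P N); last by lia.
have := Pk _ _ Pm PN; have := m_min _ PN; lia.
Qed.

(** The indices of the cutoffs that do not vanish at [t]. *)
Definition active (R : realType) (t : R) (n : nat) : bool :=
  trapezoid R (t / 2 ^+ n) != 0.

Lemma sum_active (R : realType) (t : R) (N : nat) :
  (\sum_(0 <= n < N) active R t n <= 3)%N.
Proof.
apply: window_sum => m n /trapezoid_supp/andP[_ tm] /trapezoid_supp/andP[tn _].
rewrite ltnNge; apply/negP => /subnKC nE.
have e0 k : 0 < 2 ^+ k :> R by rewrite exprn_gt0.
(* three octaves apart, 2^n / 2 >= 4 * 2^m > (5/2) * 2^m *)
move: tm tn; rewrite ltr_pdivrMr// ltr_pdivlMr// -nE !exprD.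
move: (n - _)%N => k; have k1 : 1 <= 2 ^+ k :> R by rewrite exprn_ege1// ler1n.
have : 2 ^+ m <= 2 ^+ m * 2 ^+ k :> R by rewrite ler_peMr// ltW.
rewrite [_ * 2 ^+ 3 * _]mulrAC; have := e0 m.
by rewrite !exprS expr0; lra.
Qed.

(** * Sequences with few nonzero terms *)

(** A sequence with at most [K] nonzero terms, each of norm at most [A], has
    l_p norm at most [K A]; this is crude, since [K ^ (1 / p) A] would do. *)
Lemma lp_norm_sparse (R : realType) (Y : normedModType R) (p : R)
    (y : nat -> Y) (S : pred nat) (K : nat) (A : R) :
  1 <= p -> 0 <= A -> (forall n, S n -> `|y n| <= A) ->
  (forall n, ~~ S n -> y n = 0) ->
  (forall N, (\sum_(0 <= n < N) S n <= K)%N) ->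
  y \in lp_pred p /\ lp_norm p y <= K%:R * A.
Proof.
move=> p1 A0 yA y0 SK; have p0 : 0 < p by exact: lt_le_trans p1.
apply: lp_norm_le => //; first exact: mulr_ge0.
move=> N; rewrite powRM//.
apply: (@le_trans _ _ ((\sum_(0 <= n < N) S n)%:R * A `^ p)); last first.
  apply: ler_wpM2r; first exact: powR_ge0.
  apply: (@le_trans _ _ K%:R); first by rewrite ler_nat.
  (* K <= K ^ p for a natural number K, since p >= 1 *)
  case: (K) => [|k]; first by rewrite powR_ge0.
  rewrite -[leLHS]powRr1//.
  by apply: ler_powR => //; rewrite ler1n.
rewrite natr_sum mulr_suml; apply: ler_sum => n _.
have [Sn|Sn] := boolP (S n).
  by rewrite mul1r; apply: ge0_ler_powR; rewrite ?nnegrE ?yA ?(ltW p0).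
by rewrite y0// normr0 powR0 ?gt_eqF// mul0r.
Qed.

(** * Local maps *)

Lemma mdist_dist_le {R : realType} {X : metricType R} (c x y : X) :
  `|mdist c x - mdist c y| <= mdist x y.
Proof.
rewrite ler_norml; have := metric_triangle c x y.
by have := metric_triangle c y x; rewrite (metric_sym y x); lra.
Qed.

(** The scaling factor of a local representation is absorbed by a homothety of
    [Y]. *)
Lemma normalized_representation (R : realType) (lam : R) (X : metricType R)
    (Y : normedModType R) (c : X) (r : R) : 0 < r ->
  locally_Lipschitz_representable lam X (norm_metric Y) ->
  exists g : X -> Y, g c = 0 /\ forall x y, mdist c x < r -> mdist c y < r ->
    mdist x y <= `|g x - g y| <= lam * mdist x y.
Proof.
move=> r0 /(_ c r r0)[f [s [s0 fP]]].
exists (fun x => s^-1 *: ((f x : Y) - f c)); split; first by rewrite subrr scaler0.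
move=> x y xr yr; have := fP x y; rewrite !ballEmdist => /(_ xr yr).
rewrite mdist_normE -scalerBr opprB addrA subrK normrZ gtr0_norm ?invr_gt0//.
by rewrite ler_pdivlMl// ler_pdivrMl// [s * (lam * _)]mulrCA mulrA.
Qed.

(** The cutoff of scale [r].  Replacing the distance to [c] by 1 plus that
    distance makes the scales [2 ^ n], [n] a natural number, cover all of [X]. *)
Definition cutoff {R : realType} {X : metricType R} (c : X) (r : R) (x : X) : R :=
  trapezoid R ((1 + mdist c x) / r).

Section cutoff.
Context {R : realType} {X : metricType R} {Y : normedModType R}.
Context (c : X) (r lam : R) (g : X -> Y).
Context (r0 : 0 < r) (lam0 : 0 <= lam) (gc : g c = 0).
Context (g_rep : forall x y,
  mdist c x < 5 / 2 * r -> mdist c y < 5 / 2 * r ->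
  mdist x y <= `|g x - g y| <= lam * mdist x y).

Lemma cutoff_itv x : 0 <= cutoff c r x <= 1.
Proof. exact: trapezoid_itv. Qed.

Lemma cutoff_supp x : cutoff c r x != 0 -> mdist c x < 5 / 2 * r.
Proof. by move=> /trapezoid_supp/andP[_]; rewrite ltr_pdivrMr//; lra. Qed.

(** The scale [r] cancels: the cutoff is [2 / r]-Lipschitz in the distance to
    [c], and [`|g y|] is at most [(5/2) lam r]. *)
Lemma cutoff_variation x y : mdist c y < 5 / 2 * r ->
  `|(cutoff c r x - cutoff c r y) *: g y| <=
    5 * lam * `|mdist c x - mdist c y|.
Proof.
move=> yr; rewrite normrZ.
have cr : mdist c c < 5 / 2 * r by rewrite mdistxx mulr_gt0 ?divr_gt0.
have gy : `|g y| <= lam * (5 / 2 * r).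
  have /andP[_] := g_rep y c yr cr; rewrite gc subr0 (metric_sym y).
  by move/le_trans; apply; apply: ler_wpM2l => //; exact: ltW.
apply: (@le_trans _ _ (2 * (`|mdist c x - mdist c y| / r) * (lam * (5 / 2 * r)))).
  apply: ler_pM => //; apply: (le_trans (trapezoid_lipschitz _ _ _)).
  rewrite -mulrBl opprD addrACA subrr add0r normrM [`|r^-1|]gtr0_norm//.
  by rewrite invr_gt0.
rewrite le_eqVlt; apply/orP; left; apply/eqP.
have : r / r = 1 by rewrite divff// gt_eqF.
move: (r^-1) `|mdist c x - _| => q D rq.
transitivity (5 * lam * D * (r * q)); last by rewrite rq mulr1.
by rewrite -!mulrA; lra.
Qed.

Lemma cutoff_lipschitz x y :
  `|cutoff c r x *: g x - cutoff c r y *: g y| <= 6 * lam * mdist x y.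
Proof.
wlog yx : x y / mdist c y <= mdist c x => [H|].
  have [/H//|/ltW/H] := leP (mdist c y) (mdist c x).
  by rewrite distrC metric_sym.
have D0 := mdist_ge0 x y.
have [yr|yr] := ltP (mdist c y) (5 / 2 * r); last first.
  (* both points lie off the support *)
  have c0 z : 5 / 2 * r <= mdist c z -> cutoff c r z = 0.
    by move=> zr; apply/eqP; apply: contraTT zr => /cutoff_supp; rewrite ltNge.
  rewrite !c0// ?(le_trans yr)// !scale0r subrr normr0.
  by rewrite !mulr_ge0.
have -> : cutoff c r x *: g x - cutoff c r y *: g y =
    cutoff c r x *: (g x - g y) + (cutoff c r x - cutoff c r y) *: g y.
  by rewrite scalerBr scalerBl addrA subrK.
apply: (le_trans (ler_normD _ _)).
have -> : 6 * lam * mdist x y = lam * mdist x y + 5 * lam * mdist x y by lra.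
apply: lerD; last first.
  apply: (le_trans (cutoff_variation x y yr)).
  by rewrite ler_wpM2l ?mulr_ge0// mdist_dist_le.
have [->|/cutoff_supp xr] := eqVneq (cutoff c r x) 0.
  by rewrite scale0r normr0 mulr_ge0.
have /andP[_ gxy] := g_rep x y xr yr; have /andP[cx0 cx1] := cutoff_itv x.
by rewrite normrZ ger0_norm//; apply: (le_trans _ gxy); rewrite ler_piMl.
Qed.

(** Where the cutoff is 1, the localized map keeps the lower bound of [g], up to
    the difference of the distances to [c]. *)
Lemma cutoff_expansive x y : r <= 1 + mdist c x <= 2 * r ->
  mdist c y <= mdist c x ->
  mdist x y <= `|cutoff c r x *: g x - cutoff c r y *: g y| +
               5 * lam * `|mdist c x - mdist c y|.
Proof.
move=> /andP[rx xr] yx.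
have x_lt : mdist c x < 5 / 2 * r by lra.
have y_lt : mdist c y < 5 / 2 * r by lra.
have cx : cutoff c r x = 1.
  by apply: trapezoid1; rewrite ler_pdivlMr// ler_pdivrMr// mul1r rx.
have /andP[/le_trans + _] := g_rep x y x_lt y_lt; apply.
have -> : g x - g y = cutoff c r x *: g x - cutoff c r y *: g y -
    (cutoff c r x - cutoff c r y) *: g y.
  by rewrite cx scale1r scalerBl scale1r opprB addrA subrK.
apply: (le_trans (ler_normB _ _)); rewrite lerD2l; exact: cutoff_variation.
Qed.

End cutoff.

(** * Gluing *)

(** Coordinate 0 of the glued map is the distance to [c] along [u]; coordinate
    [n.+1] is the map of scale [2 ^ n], cut off to its shell. *)
Definition glued {R : realType} {X : metricType R} {Y : normedModType R}
    (c : X) (u : Y) (g : nat -> X -> Y) (x : X) (n : nat) : Y :=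
  if n is m.+1 then cutoff c (2 ^+ m) x *: g m x else mdist c x *: u.

Section glued.
Context {R : realType} {X : metricType R} {Y : normedModType R}.
Context (c : X) (u : Y) (g : nat -> X -> Y) (lam : R).
Context (lam1 : 1 <= lam) (u1 : `|u| = 1) (gc : forall n, g n c = 0).
Context (g_rep : forall n x y,
  mdist c x < 5 / 2 * 2 ^+ n -> mdist c y < 5 / 2 * 2 ^+ n ->
  mdist x y <= `|g n x - g n y| <= lam * mdist x y).

Let lam0 : 0 <= lam. Proof. exact: le_trans lam1. Qed.

Let e0 n : 0 < 2 ^+ n :> R. Proof. by rewrite exprn_gt0. Qed.

Lemma glued_dist0 x y :
  `|glued c u g x 0 - glued c u g y 0| = `|mdist c x - mdist c y|.
Proof. by rewrite /= -scalerBl normrZ u1 mulr1. Qed.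

Lemma glued_upper p x y : 1 <= p ->
  glued c u g x - glued c u g y \in lp_pred p /\
  lp_norm p (glued c u g x - glued c u g y) <= 7 * (6 * lam * mdist x y).
Proof.
move=> p1.
(* coordinate 0, and three active scales for each of x and y: 1 + 3 + 3 = 7 *)
pose S n := if n is m.+1
  then active R (1 + mdist c x) m || active R (1 + mdist c y) m else true.
have D0 := mdist_ge0 x y.
apply: (lp_norm_sparse _ _ _ _ S 7) => // [|n Sn|[|n]//|[|N]].
- by rewrite !mulr_ge0.
- rewrite [X in `|X|](_ : _ = glued c u g x n - glued c u g y n)//.
  case: n {Sn} => [|n].
    rewrite glued_dist0; apply: (le_trans (mdist_dist_le _ _ _)).
    by rewrite ler_peMl//; have := lam1; lra.
  exact: (cutoff_lipschitz c _ _ _ (e0 n) lam0 (gc n) (g_rep n)).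
- rewrite negb_or !negbK => /andP[/eqP x0 /eqP y0].
  by rewrite [LHS](_ : _ = glued c u g x n.+1 - glued c u g y n.+1)//=
    /cutoff x0 y0 !scale0r subrr.
- by rewrite big_geq.
- rewrite big_nat_recl//=.
  apply: (@leq_trans (1 + \sum_(0 <= n < N)
    (active R (1 + mdist c x) n + active R (1 + mdist c y) n))%N).
    rewrite leq_add2l; apply: leq_sum => n _.
    by case: (active _ _ n); case: (active _ _ n).
  rewrite big_split/=; have := sum_active R (1 + mdist c x) N.
  by have := sum_active R (1 + mdist c y) N; lia.
Qed.

Lemma glued_base : glued c u g c = 0.
Proof. by apply/funext => -[|n] /=; rewrite ?mdistxx ?scale0r// gc scaler0. Qed.

Lemma glued_lower x y (M : R) :
  (forall n, `|glued c u g x n - glued c u g y n| <= M) ->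
  mdist x y <= (1 + 5 * lam) * M.
Proof.
wlog yx : x y / mdist c y <= mdist c x => [H|] leM.
  have [/H/(_ leM)//|/ltW/H] := leP (mdist c y) (mdist c x).
  by rewrite metric_sym; apply => n; rewrite distrC.
have [|n xn] := dyadic_bracket R (1 + mdist c x).
  by rewrite lerDl mdist_ge0.
rewrite exprS in xn.
(* coordinate n.+1 sees d(x, y), coordinate 0 absorbs the error term *)
have := cutoff_expansive c _ _ _ (e0 n) lam0 (gc n) (g_rep n) x y xn yx.
move/le_trans; apply; rewrite [leRHS]mulrDl mul1r.
apply: lerD; first exact: (leM n.+1).
by apply: ler_wpM2l; [exact: mulr_ge0|rewrite -glued_dist0].
Qed.

End glued.

Theorem theorem2 (R : realType) (p : R) (p1 : 1 <= p)
    (X : metricType R) (Y : completeNormedModType R) :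
  locally_biLipschitz_representable X (norm_metric Y) ->
  exists f : X -> lp_space Y p1, biLipschitz_embedding f.
Proof.
move=> [lam [lam1 rep]].
have [[c [z cz]]|X1] := pselect (exists c z : X, mdist c z != 0); last first.
  have d0 (x y : X) : mdist x y = 0.
    apply/eqP/negPn/negP => xy; apply: X1; by exists x, y.
  exists (fun=> 0), 1, 1; split=> // x y.
  by rewrite d0 !mulr0 subrr normr0 lexx.
have /choice[g gP] n : exists g : X -> Y, g c = 0 /\ forall x y,
    mdist c x < 5 / 2 * 2 ^+ n -> mdist c y < 5 / 2 * 2 ^+ n ->
    mdist x y <= `|g x - g y| <= lam * mdist x y.
  apply: normalized_representation rep.
  by rewrite mulr_gt0 ?exprn_gt0// divr_gt0.
have gc n := (gP n).1.
have g_rep n := (gP n).2.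
have lam0 : 0 <= lam by exact: le_trans lam1.
(* Y contains a unit vector because X has two points at positive distance *)
have [u u1] : exists u : Y, `|u| = 1.
  have D0 : 0 < mdist c z by rewrite lt_neqAle eq_sym cz mdist_ge0.
  have [||w [wc w_rep]] := @normalized_representation R lam X Y c (mdist c z + 1).
  - by rewrite addr_gt0.
  - exact: rep.
  have /andP[+ _] : mdist z c <= `|w z - w c| <= lam * mdist z c.
    by apply: w_rep; rewrite ?mdistxx ?addr_gt0// ltrDl.
  rewrite wc subr0 metric_sym => /(lt_le_trans D0) wz0.
  exists (`|w z|^-1 *: w z); rewrite normrZ gtr0_norm ?invr_gt0//.
  by rewrite mulVf// gt_eqF.
have upper := glued_upper c u g lam lam1 u1 gc g_rep p.
have inlp x : glued c u g x \in lp_pred p.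
  (* the upper estimate against the base point, where the glued map vanishes *)
  by have [] := upper x c p1; rewrite (glued_base c u g gc) subr0.
exists (fun x => LpSpace p1 (inlp x)).
have L0 : 0 < 1 + 5 * lam by lra.
exists (1 + 5 * lam)^-1, (7 * (6 * lam) * (1 + 5 * lam)); split.
- by rewrite invr_gt0.
- by nra.
move=> x y; apply/andP; split.
  rewrite ler_pdivrMl//.
  apply: (glued_lower c u g lam lam1 u1 gc g_rep) => n.
  exact: (ler_norm_lp_seq (LpSpace p1 (inlp x) - LpSpace p1 (inlp y))).
rewrite mulfK ?gt_eqF// -mulrA.
exact: (upper x y p1).2.
Qed.
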